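(* Suppose that $\Phi$ belongs either to $C(\mathbb{R}_{+}^{N})\cap C^{2}(\mathbb{R}_{++}^{N})$ or to $C^{2}(\mathbb{R}^{N})$. Then: (i) $\Phi$ is strongly subadditive if and only if $\Phi(\mathbf{0})\geq 0$ and all partial derivatives of second order $\frac{\partial^{2}\Phi}{\partial x_{i}\partial x_{j}}$ are nonpositive; (ii) $\Phi$ is strongly superadditive if and only if $\Phi(\mathbf{0})\leq 0$ and all partial derivatives of second order $\frac{\partial^{2}\Phi}{\partial x_{i}\partial x_{j}}$ are nonnegative.
   Context: Functions are real-valued. $\mathbb{R}_{+}^{N}=\{\mathbf{x}=(x_{1},\dots,x_{N}):x_{k}\geq 0 \text{ for } 1\leq k\leq N\}$ and $\mathbb{R}_{++}^{N}=\{\mathbf{x}=(x_{1},\dots,x_{N}):x_{k}>0 \text{ for } 1\leq k\leq N\}$. $C(\mathbb{R}_{+}^{N})\cap C^{2}(\mathbb{R}_{++}^{N})$ is the set of functions continuous on $\mathbb{R}_{+}^{N}$ and twice continuously differentiable on $\mathbb{R}_{++}^{N}$; $C^{2}(\mathbb{R}^{N})$ is the set of functions twice continuously differentiable on $\mathbb{R}^{N}$. A convex cone $\mathcal{C}$ in a real linear space is a subset such that $a\mathbf{x}+b\mathbf{y}\in\mathcal{C}$ whenever $a,b>0$ and $\mathbf{x},\mathbf{y}\in\mathcal{C}$; both $\mathbb{R}_{+}^{N}$ and $\mathbb{R}^{N}$ itself are convex cones. A function $\Phi:\mathcal{C}\rightarrow\mathbb{R}$ defined on a convex cone $\mathcal{C}$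 is subadditive if $\Phi(\mathbf{x}+\mathbf{y})\leq\Phi(\mathbf{x})+\Phi(\mathbf{y})$ for all $\mathbf{x},\mathbf{y}\in\mathcal{C}$, and it is strongly subadditive if in addition $\Phi(\mathbf{x}+\mathbf{y}+\mathbf{z})+\Phi(\mathbf{z})\leq\Phi(\mathbf{x}+\mathbf{z})+\Phi(\mathbf{y}+\mathbf{z})$ for all $\mathbf{x},\mathbf{y},\mathbf{z}\in\mathcal{C}$. The function $\Phi$ is strongly superadditive if $-\Phi$ is strongly subadditive.
   Formalization: For Φ in C²(R^N) the equivalences are proved on the cone R_+^N, with second partials taken on R_+^N; on the cone R^N only the ''only if'' parts are stated, since the ''if'' parts fail there (N=1, Φ(x)=−x² for (i), x² for (ii)). *)

(* Defs.v *)
From HB Require Import structures.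
From mathcomp Require Import all_boot all_order all_algebra.
From mathcomp Require Import boolp classical_sets reals topology normedtype derive.
Import Order.TTheory GRing.Theory Num.Theory.
Import numFieldNormedType.Exports.

Set Implicit Arguments.
Unset Strict Implicit.
Unset Printing Implicit Defensive.

Local Open Scope classical_set_scope.
Local Open Scope ring_scope.

Definition nonneg_orthant (R : realType) (N : nat) : set 'rV[R]_N :=
  [set x | forall k : 'I_N, 0 <= x 0 k].

Definition pos_orthant (R : realType) (N : nat) : set 'rV[R]_N :=
  [set x | forall k : 'I_N, 0 < x 0 k].

Arguments nonneg_orthant : clear implicits.
Arguments pos_orthant : clear implicits.

Definition partial (R : realType) (N : nat) (i : 'I_N)
    (f : 'rV[R]_N -> R) : 'rV[R]_N -> R :=
  fun x => 'D_(delta_mx 0 i) f x.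

(* Meant for open U: derivatives and continuity at a point of U are those of f
   on a full neighbourhood of that point. As 'D is a total operator, existence
   of the derivatives has to be required separately. *)
Definition C2_on (R : realType) (N : nat) (U : set 'rV[R]_N)
    (f : 'rV[R]_N -> R) : Prop :=
  forall x, U x ->
    [/\ {for x, continuous f},
        forall i, derivable f x (delta_mx 0 i)
                  /\ {for x, continuous (partial i f)}
      & forall i j, derivable (partial j f) x (delta_mx 0 i)
                    /\ {for x, continuous (partial i (partial j f))} ].

(* A function on a cone C is represented by a total function, of which only the
   values on C are used (C is closed under addition). *)
Definition subadditive_on (R : realType) (N : nat) (C : set 'rV[R]_N)
    (f : 'rV[R]_N -> R) : Prop :=
  forall x y, C x -> C y -> f (x + y) <= f x + f y.

Definition strongly_subadditive_on (R : realType) (N : nat)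
    (C : set 'rV[R]_N) (f : 'rV[R]_N -> R) : Prop :=
  subadditive_on C f /\
  forall x y z, C x -> C y -> C z ->
    f (x + y + z) + f z <= f (x + z) + f (y + z).

Definition strongly_superadditive_on (R : realType) (N : nat)
    (C : set 'rV[R]_N) (f : 'rV[R]_N -> R) : Prop :=
  strongly_subadditive_on C (fun x => - f x).

Definition second_partials_le0_on (R : realType) (N : nat)
    (U : set 'rV[R]_N) (f : 'rV[R]_N -> R) : Prop :=
  forall (i j : 'I_N) x, U x -> partial i (partial j f) x <= 0.

Definition second_partials_ge0_on (R : realType) (N : nat)
    (U : set 'rV[R]_N) (f : 'rV[R]_N -> R) : Prop :=
  forall (i j : 'I_N) x, U x -> 0 <= partial i (partial j f) x.

(* Main.v *)
Require Import Defs.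
From HB Require Import structures.
From mathcomp Require Import all_boot all_order all_algebra.
From mathcomp Require Import boolp classical_sets reals topology normedtype derive.
From mathcomp Require Import functions lra.
Import Order.TTheory GRing.Theory Num.Theory.
Import numFieldNormedType.Exports.
Local Open Scope classical_set_scope.
Local Open Scope ring_scope.

(** Necessity: a mixed second partial derivative is an iterated one-sided limit
    of quotients of the mixed differences
    [Phi (z + s e_i + t e_j) - Phi (z + s e_i) - Phi (z + t e_j) + Phi z],
    which strong subadditivity makes nonpositive.  Sufficiency: nonpositive
    second partials make these axis-parallel differences nonpositive, by
    one-variable monotonicity applied twice; mixed differences are additive in
    each direction, so the directions may then be arbitrary vectors of the
    orthant.  On the boundary of the orthant the inequality follows by
    continuity, and [z = 0] gives subadditivity since [Phi 0 >= 0].  Part (ii)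
    is part (i) for [- Phi]. *)

(** * Directional derivatives along lines and rays *)

Section DirectionalDerivative.
Context {R : realType} {V : normedModType R}.
Implicit Types (f : V -> R) (x z v a : V).

Lemma is_derive_translate f x v a (df : R) :
  is_derive (x + a) v f df -> is_derive x v (fun w => f (w + a)) df.
Proof.
move=> [dvf <-].
have E : (fun h : R => h^-1 *: (((fun w => f (w + a)) \o shift x) (h *: v)
                                - f (x + a)))
       = (fun h : R => h^-1 *: ((f \o shift (x + a)) (h *: v) - f (x + a))).
  by apply/funext => h; rewrite /= addrA.
by apply: DeriveDef; rewrite /derivable /derive E.
Qed.

Lemma is_derive_line f z v (r df : R) :
  is_derive (z + r *: v) v f df ->
  is_derive r (1 : R) (fun t : R => f (z + t *: v)) df.
Proof.
move=> [dvf <-].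
have E : (fun h : R => h^-1 *: (((fun t : R => f (z + t *: v)) \o shift r)
                                  (h *: (1 : R)) - f (z + r *: v)))
       = (fun h : R => h^-1 *: ((f \o shift (z + r *: v)) (h *: v)
                                - f (z + r *: v))).
  by apply/funext => h; rewrite /= [h *: 1]mulr1 scalerDl addrCA.
by apply: DeriveDef; rewrite /derivable /derive E.
Qed.

(** A derivative is also the limit of its right-hand quotients, and inside the orthant only
    increments in nonnegative directions are controlled. *)
Lemma derive_le0_right f x v : derivable f x v ->
  (forall h : R, 0 < h -> f (h *: v + x) <= f x) -> 'D_v f x <= 0.
Proof.
move=> dvf fle; have /cvg_dnbhs_at_right := dvf.
move=> /cvgr_to_le; apply.
near=> h; have h0 : 0 < h by near: h; exact: nbhs_right_gt.
by rewrite /= /GRing.scale /= pmulr_rle0 ?invr_gt0// subr_le0 fle.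
Unshelve. all: by end_near. Qed.

(** One-variable monotonicity for [t |-> f (z + t *: v)] on [[0, s]]. *)
Lemma derive_le0_line f z v (s : R) : 0 <= s ->
  (forall r : R, 0 <= r -> derivable f (z + r *: v) v) ->
  (forall r : R, 0 <= r -> 'D_v f (z + r *: v) <= 0) ->
  f (z + s *: v) <= f z.
Proof.
move=> s0 dvf Df.
have line (r : R) : 0 <= r -> is_derive r (1 : R) (fun t : R => f (z + t *: v))
                                 ('D_v f (z + r *: v)).
  by move=> r0; apply: is_derive_line; apply: DeriveDef => //; exact: dvf.
have fz : f z = f (z + 0 *: v) by rewrite scale0r addr0.
rewrite {}fz.
apply: (@ler0_derive1_le_cc R (fun t : R => f (z + t *: v)) 0 s) => //;
  rewrite ?in_itv/= ?lexx ?s0//.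
- by move=> r; rewrite in_itv/= => /andP[/ltW /line [] ].
- move=> r; rewrite in_itv/= => /andP[/ltW r0 _].
  by rewrite derive1E; have [_ ->] := line _ r0; exact: Df.
- apply: derivable_within_continuous => r.
  by rewrite in_itv/= => /andP[/line [] ].
Qed.

(* Where [f] is not derivable both sides are the junk value [0]. *)
Lemma derive_opp f x v : 'D_v (- f) x = - 'D_v f x.
Proof.
have [dvf|ndvf] := pselect (derivable f x v); first exact: deriveN.
have D0 (g : V -> R) : ~ derivable g x v -> 'D_v g x = 0 by exact: dvgP.
rewrite (D0 f ndvf) D0 ?oppr0// => dvNf; apply: ndvf.
by rewrite -[f]opprK; exact: derivableN.
Qed.

End DirectionalDerivative.

(** * Stability under change of sign *)

Section Orthant.
Context {R : realType} {N : nat}.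
Implicit Types (f : 'rV[R]_N -> R) (x y z : 'rV[R]_N) (U C : set 'rV[R]_N).

Lemma partialN i f : partial i (- f) = - partial i f.
Proof. by apply/funext => x; exact: derive_opp. Qed.

Lemma C2_onN U f : C2_on U f -> C2_on U (- f).
Proof.
move=> C2f x Ux; have [cf df ddf] := C2f x Ux; split.
- exact: continuousN.
- by move=> i; rewrite partialN; split;
    [exact: derivableN (df i).1 | exact: continuousN (df i).2].
- by move=> i j; rewrite !partialN; split;
    [exact: derivableN (ddf i j).1 | exact: continuousN (ddf i j).2].
Qed.

Lemma second_partials_le0N U f :
  second_partials_le0_on U (- f) <-> second_partials_ge0_on U f.
Proof.
by split=> D i j x Ux; have := D i j x Ux; rewrite !partialN oppr_le0.
Qed.

(** * The nonnegative orthant as a cone *)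

Lemma nonneg_orthantD x y :
  nonneg_orthant R N x -> nonneg_orthant R N y -> nonneg_orthant R N (x + y).
Proof. by move=> x0 y0 k; rewrite mxE addr_ge0. Qed.

Lemma nonneg_orthant0 : nonneg_orthant R N 0.
Proof. by move=> k; rewrite mxE. Qed.

Lemma nonneg_orthantZ_delta (s : R) i :
  0 <= s -> nonneg_orthant R N (s *: delta_mx 0 i).
Proof. by move=> s0 k; rewrite !mxE mulr_ge0// ler0n. Qed.

(** A vector of the orthant is the sum of its coordinate components, which are nonnegative multiples
    of the basis vectors. *)
Lemma nonneg_orthant_ind (P : 'rV[R]_N -> Prop) :
  P 0 ->
  (forall x y, nonneg_orthant R N x -> nonneg_orthant R N y ->
    P x -> P y -> P (x + y)) ->
  (forall (s : R) i, 0 <= s -> P (s *: delta_mx 0 i)) ->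
  forall x, nonneg_orthant R N x -> P x.
Proof.
move=> P0 PD Pe x x0; rewrite [x]row_sum_delta.
(* Membership is carried along because the sum clause asks for both summands in the orthant. *)
suff [] : nonneg_orthant R N (\sum_j x 0 j *: delta_mx 0 j)
          /\ P (\sum_j x 0 j *: delta_mx 0 j) by [].
elim/big_ind: _ => [|u v [u0 Pu] [v0 Pv]|i _].
- by split=> //; exact: nonneg_orthant0.
- by split; [exact: nonneg_orthantD | exact: PD].
- by split; [exact: nonneg_orthantZ_delta | exact: Pe].
Qed.

(** * Algebra of mixed second-order differences *)

Definition mixed_diff f x y z := f (x + y + z) + f z - f (x + z) - f (y + z).

Lemma mixed_diffC f x y z : mixed_diff f x y z = mixed_diff f y x z.
Proof. by rewrite /mixed_diff [y + x]addrC addrAC. Qed.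

Lemma mixed_diff0 f y z : mixed_diff f 0 y z = 0.
Proof. by rewrite /mixed_diff !add0r; lra. Qed.

(** The path from [z] by [x'] and then by [x]: the values at [x' + z] and [x' + y + z] cancel. The
    base point moves, so sign statements must quantify over it. *)
Lemma mixed_diffD f x x' y z :
  mixed_diff f (x + x') y z = mixed_diff f x y (x' + z) + mixed_diff f x' y z.
Proof.
rewrite /mixed_diff (_ : x + y + (x' + z) = x + x' + y + z); last first.
  by rewrite !addrA; congr (_ + _); rewrite addrAC.
by rewrite !addrA [y + x']addrC; lra.
Qed.

(** * Mixed differences and second partial derivatives *)

(** Letting [U] be any set stable under translation by the orthant covers the open orthant, the
    closed one and the whole space at once. *)
Lemma second_partials_le0_of_mixed_diff U f : C2_on U f ->
  (forall x y, nonneg_orthant R N x -> U y -> U (x + y)) ->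
  (forall x y z, nonneg_orthant R N x -> nonneg_orthant R N y -> U z ->
    mixed_diff f x y z <= 0) ->
  second_partials_le0_on U f.
Proof.
move=> C2f UD mixed i j x Ux.
apply: derive_le0_right => [|h h0]; first by have [_ _ /(_ i j)[]] := C2f x Ux.
set a := h *: _; have a0 : nonneg_orthant R N a.
  exact/nonneg_orthantZ_delta/ltW.
have df y : U y -> derivable f y (delta_mx 0 j).
  by move=> /C2f[_ /(_ j)[]].
(* The increment of [partial j f] along [a] is itself a [j]-th partial derivative, that of
   [f (w + a) - f w], whose increments are mixed differences of [f]. *)
have dg : is_derive x (delta_mx 0 j) ((fun w => f (w + a)) - f)
                    (partial j f (x + a) - partial j f x).
  apply: is_deriveB; last by apply: DeriveDef => //; exact: df.
  apply: is_derive_translate; apply: DeriveDef => //.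
  by apply: df; rewrite addrC; exact: UD.
rewrite -subr_le0 [a + x]addrC; have [dvg <-] := dg.
apply: derive_le0_right => // t t0.
have b0 : nonneg_orthant R N (t *: delta_mx 0 j).
  exact/nonneg_orthantZ_delta/ltW.
have := mixed a (t *: delta_mx 0 j) x a0 b0 Ux.
rewrite /mixed_diff !fctE -[a + _ + x]addrA [a + (_ + _)]addrC [a + x]addrC; lra.
Qed.

Lemma mixed_diff_le0_of_second_partials U f : C2_on U f ->
  (forall x y, nonneg_orthant R N x -> U y -> U (x + y)) ->
  second_partials_le0_on U f ->
  forall x y z, nonneg_orthant R N x -> nonneg_orthant R N y -> U z ->
    mixed_diff f x y z <= 0.
Proof.
move=> C2f UD D.
(* Axis-parallel case: the mixed difference is an increment of [f (w + a) - f w] along the [j]-th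
   axis. *)
have axes (s t : R) i j z : 0 <= s -> 0 <= t -> U z ->
    mixed_diff f (s *: delta_mx 0 i) (t *: delta_mx 0 j) z <= 0.
  move=> s0 t0 Uz; set a := s *: _.
  have a0 : nonneg_orthant R N a by exact: nonneg_orthantZ_delta.
  have Uz' (r : R) k y : 0 <= r -> U y -> U (y + r *: delta_mx 0 k).
    by move=> r0 Uy; rewrite addrC; apply: UD => //; exact: nonneg_orthantZ_delta.
  have dg y : U y -> is_derive y (delta_mx 0 j) ((fun w => f (w + a)) - f)
                    (partial j f (y + a) - partial j f y).
    move=> Uy; have df w : U w -> derivable f w (delta_mx 0 j).
      by move=> /C2f[_ /(_ j)[]].
    apply: is_deriveB; last by apply: DeriveDef => //; exact: df.
    by apply: is_derive_translate; apply: DeriveDef => //; exact/df/Uz'.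
  have := @derive_le0_line _ _ ((fun w => f (w + a)) - f) z (delta_mx 0 j) t t0.
  have -> : mixed_diff f a (t *: delta_mx 0 j) z
      = ((fun w => f (w + a)) - f) (z + t *: delta_mx 0 j)
        - ((fun w => f (w + a)) - f) z.
    rewrite /mixed_diff !fctE -[a + _ + z]addrA [a + (_ + _)]addrC [a + z]addrC.
    by rewrite [_ + z]addrC; lra.
  rewrite subr_le0; apply=> r r0.
    by have [] := dg _ (Uz' _ j _ r0 Uz).
  have [_ ->] := dg _ (Uz' _ j _ r0 Uz); rewrite subr_le0.
  (* The derivative of that function is an increment of [partial j f] along the [i]-th axis, so its
     sign follows from that of a second partial. *)
  apply: derive_le0_line => // q q0.
    by have [_ _ /(_ i j)[]] := C2f _ (Uz' _ i _ q0 (Uz' _ j _ r0 Uz)).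
  exact: D (Uz' _ i _ q0 (Uz' _ j _ r0 Uz)).
(* Arbitrary directions: induction on [x], then on [y] once [x] is an axis vector; [z] stays general
   because [mixed_diffD] moves it. *)
move=> x y z x0 y0; move: x x0 z.
apply: nonneg_orthant_ind => [z _|x x' x0 x'0 Px Px' z Uz|s i s0].
- by rewrite mixed_diff0.
- by rewrite mixed_diffD; have := Px _ (UD _ _ x'0 Uz); have := Px' _ Uz; lra.
move: y y0; apply: nonneg_orthant_ind => [z _|y y' y0 y'0 Py Py' z Uz|t j t0 z Uz].
- by rewrite mixed_diffC mixed_diff0.
- rewrite mixed_diffC mixed_diffD ![mixed_diff f _ (s *: _) _]mixed_diffC.
  by have := Py _ (UD _ _ y'0 Uz); have := Py' _ Uz; lra.
- exact: axes.
Qed.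

(** * Strong subadditivity through mixed differences *)

Lemma strongly_subadditive_mixed_diff C f :
  strongly_subadditive_on C f -> forall x y z, C x -> C y -> C z ->
  mixed_diff f x y z <= 0.
Proof.
by move=> [_ sf] x y z Cx Cy Cz; have := sf x y z Cx Cy Cz; rewrite /mixed_diff; lra.
Qed.

Lemma mixed_diff_strongly_subadditive C f : C 0 -> 0 <= f 0 ->
  (forall x y z, C x -> C y -> C z -> mixed_diff f x y z <= 0) ->
  strongly_subadditive_on C f.
Proof.
move=> C0 f0 mixed; split=> [x y Cx Cy|x y z Cx Cy Cz].
  by have := mixed x y 0 Cx Cy C0; rewrite /mixed_diff !addr0; lra.
by have := mixed x y z Cx Cy Cz; rewrite /mixed_diff; lra.
Qed.

Lemma subadditive_ge0 C f : C 0 -> subadditive_on C f -> 0 <= f 0.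
Proof. by move=> C0 /(_ 0 0 C0 C0); rewrite addr0; lra. Qed.

(** * Passage to the boundary of the orthant *)

Lemma nonneg_pos_orthantD x y :
  nonneg_orthant R N x -> pos_orthant R N y -> pos_orthant R N (x + y).
Proof. by move=> x0 y0 k; rewrite mxE ltr_wpDl. Qed.

Lemma pos_orthantW : pos_orthant R N `<=` nonneg_orthant R N.
Proof. by move=> x x0 k; exact/ltW/x0. Qed.

(** The diagonal shift approaches [x] from inside the orthant, where relative continuity applies. *)
Lemma cvg_pos_translate f x :
  {within nonneg_orthant R N, continuous f} -> nonneg_orthant R N x ->
  f (x + e *: const_mx 1) @[e --> 0^'+] --> f x.
Proof.
move=> /subspace_continuousP cf x0 B /(cf x x0).
have : x + e *: const_mx 1 @[e --> (0 : R)^'+] --> x.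
  apply: cvg_at_right_filter; rewrite -[X in _ --> X]addr0 -(scale0r (const_mx 1)).
  apply: cvgD; first exact: cvg_cst.
  exact: (@scalel_continuous R _ (const_mx 1 : 'rV[R]_N) (0 : R)).
move=> /[apply]; rewrite /nbhs /= => B0.
near=> e; have e0 : 0 < e by near: e; exact: nbhs_right_gt.
(* Relative continuity yields membership in [B] only at points of the orthant, which the translates
   are. *)
have /= : nonneg_orthant R N (x + e *: const_mx 1) ->
          B (f (x + e *: const_mx 1)) by near: e.
by apply=> k; rewrite !mxE mulr1 addr_ge0// ltW.
Unshelve. all: by end_near. Qed.

(** Only the base point is pushed into the interior; the mixed differences there are nonpositive,
    hence so is their limit. *)
Lemma mixed_diff_le0_closure f : {within nonneg_orthant R N, continuous f} ->
  (forall x y z, nonneg_orthant R N x -> nonneg_orthant R N y ->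
    pos_orthant R N z -> mixed_diff f x y z <= 0) ->
  forall x y z, nonneg_orthant R N x -> nonneg_orthant R N y ->
    nonneg_orthant R N z -> mixed_diff f x y z <= 0.
Proof.
move=> cf mixed x y z x0 y0 z0.
have : mixed_diff f x y (z + e *: const_mx 1) @[e --> 0^'+]
       --> mixed_diff f x y z.
  rewrite /mixed_diff.
  have lim w : nonneg_orthant R N w ->
      f (w + (z + e *: const_mx 1)) @[e --> 0^'+] --> f (w + z).
    move=> w0; under eq_fun do rewrite addrA.
    exact/cvg_pos_translate/nonneg_orthantD.
  apply: cvgB; last exact: lim.
  apply: cvgB; last exact: lim.
  apply: cvgD; last exact: cvg_pos_translate.
  exact/lim/nonneg_orthantD.
move=> /cvgr_to_le; apply.
near=> e; have e0 : 0 < e by near: e; exact: nbhs_right_gt.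
by apply: mixed => // k; rewrite !mxE mulr1 ltr_wpDl.
Unshelve. all: by end_near. Qed.

(** * Criteria for each domain *)

Lemma strongly_subadditive_pos_orthantP f :
  {within nonneg_orthant R N, continuous f} -> C2_on (pos_orthant R N) f ->
  strongly_subadditive_on (nonneg_orthant R N) f <->
  0 <= f 0 /\ second_partials_le0_on (pos_orthant R N) f.
Proof.
move=> cf C2f; split=> [sf|[f0 D]].
  split; first exact: subadditive_ge0 nonneg_orthant0 sf.1.
  apply: second_partials_le0_of_mixed_diff => // [|x y z x0 y0 /pos_orthantW].
    exact: nonneg_pos_orthantD.
  exact: strongly_subadditive_mixed_diff.
apply: mixed_diff_strongly_subadditive => //; first exact: nonneg_orthant0.
apply: mixed_diff_le0_closure => //.
exact: (mixed_diff_le0_of_second_partials _ _ C2f nonneg_pos_orthantD D).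
Qed.

Lemma strongly_subadditive_nonneg_orthantP f : C2_on setT f ->
  strongly_subadditive_on (nonneg_orthant R N) f <->
  0 <= f 0 /\ second_partials_le0_on (nonneg_orthant R N) f.
Proof.
(* Derivatives exist at boundary points too, so the closed orthant itself serves as [U] and no limit
   is taken. *)
move=> C2f; have {}C2f : C2_on (nonneg_orthant R N) f.
  by move=> x _; exact: C2f.
split=> [sf|[f0 D]].
  split; first exact: subadditive_ge0 nonneg_orthant0 sf.1.
  apply: second_partials_le0_of_mixed_diff => //; first exact: nonneg_orthantD.
  exact: strongly_subadditive_mixed_diff.
apply: mixed_diff_strongly_subadditive => //; first exact: nonneg_orthant0.
exact: (mixed_diff_le0_of_second_partials _ _ C2f nonneg_orthantD D).
Qed.

Lemma strongly_subadditive_setT f : C2_on setT f ->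
  strongly_subadditive_on setT f ->
  0 <= f 0 /\ second_partials_le0_on setT f.
Proof.
move=> C2f sf; split; first by apply: (@subadditive_ge0 setT) => //; exact: sf.1.
apply: second_partials_le0_of_mixed_diff => // x y z _ _ _.
exact: strongly_subadditive_mixed_diff sf _ _ _ _ _ _.
Qed.

End Orthant.

(** Over [setT] only necessity is asserted: on the line, [- x ^ 2] satisfies the sign conditions of
    (i) but is not subadditive at the pair [1], [-1]. *)
Theorem theorem4 (R : realType) (N : nat) (Phi : 'rV[R]_N -> R) :
  ({within nonneg_orthant R N, continuous Phi} ->
   C2_on (pos_orthant R N) Phi ->
     (strongly_subadditive_on (nonneg_orthant R N) Phi <->
        0 <= Phi 0 /\ second_partials_le0_on (pos_orthant R N) Phi)
     /\
     (strongly_superadditive_on (nonneg_orthant R N) Phi <->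
        Phi 0 <= 0 /\ second_partials_ge0_on (pos_orthant R N) Phi))
  /\
  (C2_on setT Phi ->
     ((strongly_subadditive_on (nonneg_orthant R N) Phi <->
         0 <= Phi 0 /\ second_partials_le0_on (nonneg_orthant R N) Phi)
      /\
      (strongly_superadditive_on (nonneg_orthant R N) Phi <->
         Phi 0 <= 0 /\ second_partials_ge0_on (nonneg_orthant R N) Phi))
     /\
     ((strongly_subadditive_on setT Phi ->
         0 <= Phi 0 /\ second_partials_le0_on setT Phi)
      /\
      (strongly_superadditive_on setT Phi ->
         Phi 0 <= 0 /\ second_partials_ge0_on setT Phi))).
Proof.
have oppE : (fun x => - Phi x) = - Phi by [].
have le0N : (0 <= (- Phi) 0) = (Phi 0 <= 0) by rewrite fctE oppr_ge0.
rewrite /strongly_superadditive_on oppE.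
split=> [cPhi C2Phi|C2Phi].
  split; first exact: strongly_subadditive_pos_orthantP.
  rewrite -second_partials_le0N -le0N.
  apply: strongly_subadditive_pos_orthantP; last exact: C2_onN.
  by move=> x; exact/continuousN/cPhi.
have C2N := C2_onN _ _ C2Phi.
split; split.
- exact: strongly_subadditive_nonneg_orthantP.
- rewrite -second_partials_le0N -le0N.
  exact: strongly_subadditive_nonneg_orthantP.
- exact: strongly_subadditive_setT.
- rewrite -second_partials_le0N -le0N.
  exact: strongly_subadditive_setT.
Qed.
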